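(* Let $p$ be a prime with $p\equiv 3\pmod 4$, let $q$ be a prime power with $q\equiv 3\pmod 4$ and $\gcd(p,q)=1$, set $n=2p$, and assume $\mathrm{ord}_{4p}(q)=p-1$ and $\mathrm{ord}_p(q)\equiv 2\pmod 4$ (so that $x^n+1=(x^2+1)g_1(x)g_2(x)$ over $\mathbb{F}_q$ with $g_1,g_2$ irreducible self-reciprocal of degree $p-1$). Then: (1) the number of elements $h\in R$ such that the double-negacirculant code $C_h$ of length $2n$ is self-dual equals $(q+1)\left(q^{\frac{p-1}{2}}+1\right)^2$; (2) the number of pairs $(a,b)\in R^2$ such that the four-negacirculant code $C_{a,b}$ of length $4n$ is self-dual equals $$(q+1)(q^2-q)\left(q^{\frac{p-1}{2}}+1\right)^2\left(q^{p-1}-q^{\frac{p-1}{2}}\right)^2.$$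
   Context: $R=\mathbb{F}_q[x]/\langle x^n+1\rangle$; an element $a=a_0+a_1x+\dots+a_{n-1}x^{n-1}\in R$ is identified with its coefficient vector, and its associated negacirculant matrix is the $n\times n$ matrix with first row $(a_0,\dots,a_{n-1})$ whose each subsequent row is the negashift $(x_0,\dots,x_{n-1})\mapsto(-x_{n-1},x_0,\dots,x_{n-2})$ of the previous one. For $h\in R$ with negacirculant matrix $H$, $C_h$ is the $[2n,n]$ code over $\mathbb{F}_q$ generated by $(I_n\ H)$ (as an $R$-module, generated by $(1,h)$). For $a,b\in R$ with negacirculant matrices $A,B$, $C_{a,b}$ is the $[4n,2n]$ code generated by $\begin{pmatrix} I_n & 0 & A & B\\ 0 & I_n & -B^t & A^t\end{pmatrix}$ (as an $R$-module in $R^4$, generated by $(1,0,a,b)$ and $(0,1,-b',a')$, where $a'(x)=a(-x^{n-1}) \bmod x^n+1$, $b'(x)=b(-x^{n-1}) \bmod x^n+1$). Self-dual means equal to its dual with respect to the standard Euclidean inner product. $\mathrm{ord}_m(q)$ is the multiplicative order of $q$ modulo $m$; a polynomial $f$ with $f(0)\ne0$ is self-reciprocal if $f(0)^{-1}x^{\deg f}f(x^{-1})=f(x)$. *)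

(* Defs.v *)
From HB Require Import structures.
From mathcomp Require Import all_boot all_order all_algebra all_fingroup all_field.
Set Implicit Arguments. Unset Strict Implicit. Unset Printing Implicit Defensive.
Import GRing.Theory.
Local Open Scope ring_scope.

(* Elements of R = F[x]/<x^n+1> are identified with coefficient row vectors
   (a_0, ..., a_{n-1}) : 'rV[F]_n.  [coef a k] is a_k (0 if k >= n). *)
Definition coef (F : ringType) (n : nat) (a : 'rV[F]_n) (k : nat) : F :=
  if @insub nat (fun i => i < n)%N 'I_n k is Some k' then a 0 k' else 0.

(* Negacirculant matrix: first row a, each next row is the negashift
   (x_0,...,x_{n-1}) |-> (-x_{n-1}, x_0, ..., x_{n-2}) of the previous one.
   Entry (i,j) = a_{j-i} if i <= j, and -a_{n+j-i} otherwise. *)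
Definition negacirc (F : ringType) (n : nat) (a : 'rV[F]_n) : 'M[F]_n :=
  \matrix_(i < n, j < n)
    (if (i <= j)%N then coef a (j - i) else - coef a (n + j - i)).

(* The dual of the code spanned by the rows of G (standard Euclidean inner
   product) is spanned by the rows of kermx G^T = {u | u *m G^T = 0};
   self-dual: the code equals its dual (as row spaces). *)
Definition self_dual (F : fieldType) (k N : nat) (G : 'M[F]_(k, N)) : bool :=
  (G == kermx G^T)%MS.

Definition gen_dn (F : fieldType) (n : nat) (h : 'rV[F]_n) : 'M[F]_(n, n + n) :=
  row_mx 1%:M (negacirc h).

Definition gen_fn (F : fieldType) (n : nat) (a b : 'rV[F]_n)
  : 'M[F]_(n + n, (n + n) + (n + n)) :=
  let A := negacirc a in let B := negacirc b in
  col_mx (row_mx (row_mx 1%:M 0) (row_mx A B))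
         (row_mx (row_mx 0 1%:M) (row_mx (- B^T) A^T)).

Definition mult_order_is (m a k : nat) : bool :=
  [&& (0 < k)%N, (a ^ k == 1 %[mod m])%N &
      [forall j : 'I_k, (0 < j)%N ==> (a ^ j != 1 %[mod m])%N]].

(* Main.v *)
Require Import Defs.
From HB Require Import structures.
From mathcomp Require Import all_boot all_order all_algebra all_fingroup all_field.
From mathcomp Require Import ring zify.

(** For z^n = -1 the vector (1, z, ..., z^(n-1)) is an eigenvector of the
    negacirculant matrix of a for the eigenvalue a(z), and of its transpose for
    a(1/z).  Hence C_h is self-dual iff h(z) h(1/z) = -1 at all roots z of
    x^n + 1, and C_(a,b) is self-dual iff a(z) a(1/z) + b(z) b(1/z) = -1 there.
    In an extension of F containing a primitive 4p-th root of unity z, every root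
    of x^(2p) + 1 is conjugate over F to one of z^p, z, -z, and evaluation at
    these three points is a bijection of R onto F_(q^2) x F_(r^2) x F_(r^2),
    where r = q^((p-1)/2): it is injective because a polynomial of degree < 2p
    vanishing at them has 2p roots, and both sides have the same size.  Since
    4p divides r + 1 and 4 divides q + 1, the map z |-> 1/z acts at these points
    as the Frobenius of order 2, so the conditions become the norm equation
    N(y) = -1 or N(y) + N(y') = -1 in each factor.  *)

(** * Roots of unity and power equations in finite fields *)

Section FiniteFields.
Set Implicit Arguments. Unset Strict Implicit. Unset Printing Implicit Defensive.
Import GRing.Theory.
Local Open Scope ring_scope.

(** In a splitting field of X^N - 1 the invertibility of [N] gives separability, hence N distinct
    N-th roots of unity, and these form a cyclic group. *)
Lemma prim_root_extension (F : finFieldType) (N : nat) : N%:R != 0 :> F ->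
  exists (L : finFieldType) (phi : {rmorphism F -> L}) (w : L),
    N.-primitive_root w.
Proof.
move=> N0; have N_gt0: (0 < N)%N by case: N N0 => //; rewrite eqxx.
have /FinSplittingFieldFor[/= L [rs Drs _]]: 'X^N - 1 != 0 :> {poly F}.
  by rewrite monic_neq0 ?monicXnsubC.
exists (FinFieldExtType L), (in_alg L).
rewrite rmorphB rmorphXn /= map_polyX rmorph1 in Drs.
have{}Drs: 'X^N - 1 = \prod_(z <- rs) ('X - z%:P) :> {poly L}.
  by apply/eqP; rewrite -eqp_monic ?monicXnsubC ?monic_prod_XsubC.
have Urs: uniq rs.
  rewrite -separable_prod_XsubC -Drs cyclotomic.separable_Xn_sub_1 //.
  by rewrite -(rmorph_nat (in_alg L)) fmorph_eq0.
have Srs: size rs = N.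
  by apply: succn_inj; rewrite -(size_XnsubC (1 : L) N_gt0) Drs size_prod_XsubC.
have /hasP[w _ prim_w]: has N.-primitive_root rs.
  apply: cyclic.has_prim_root; rewrite ?Srs //.
  by apply/allP=> z rs_z; rewrite /root_of_unity Drs root_prod_XsubC.
by exists w.
Qed.

Lemma prim_root_dvd_card (L : finFieldType) N (w : L) :
  N.-primitive_root w -> (N %| #|L|.-1)%N.
Proof.
move=> prim_w; rewrite (prim_order_dvd prim_w).
have w0: w != 0 by rewrite (prim_root_eq0 prim_w) -lt0n (prim_order_gt0 prim_w).
apply/eqP/(mulfI w0); rewrite mulr1 -exprS prednK ?expf_card //.
exact: ltnW (card_finNzRing_gt1 L).
Qed.

(** As [c ^+ k = 1], X^m - c divides X^(mk) - 1, hence also X^#|L| - X, the product of X - x over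
    all x in [L]; so it splits with distinct roots. *)
Lemma card_nth_roots (L : finFieldType) (m k : nat) (c : L) :
    #|L|.-1 = (m * k)%N -> (0 < m)%N -> c ^+ k = 1 ->
  #|[set y : L | y ^+ m == c]| = m.
Proof.
move=> DL m_gt0 ck1.
have dvd: 'X^m - c%:P %| \prod_(x <- enum L) ('X - x%:P).
  rewrite big_enum -finField_genPoly.
  have ->: #|L| = (m * k).+1 by rewrite -DL prednK // ltnW ?card_finNzRing_gt1.
  rewrite exprS -[X in _ %| _ - X]mulr1 -mulrBr dvdp_mull // exprM.
  have ->: 1 = (c%:P) ^+ k :> {poly L} by rewrite -rmorphXn /= ck1 rmorph1.
  by rewrite subrXX dvdp_mulr.
have [b] := dvdp_prod_XsubC dvd; set s := mask _ _.
rewrite eqp_monic ?monicXnsubC ?monic_prod_XsubC // => /eqP Ds.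
have Us: uniq s by rewrite mask_uniq ?enum_uniq.
apply: succn_inj; rewrite -(size_XnsubC c m_gt0) Ds size_prod_XsubC.
rewrite -(card_uniqP Us); congr _.+1; apply: eq_card => y.
rewrite inE -root_prod_XsubC -Ds /root !hornerE.
by rewrite subr_eq0.
Qed.

(** The fixed points are 0 and the roots of unity of order dividing M - 1. For M a suitable prime
    power this is the size of a subfield. *)
Lemma card_fixed_expn (L : finFieldType) (M : nat) :
  (1 < M)%N -> (M.-1 %| #|L|.-1)%N -> #|[set y : L | y ^+ M == y]| = M.
Proof.
case: M => [|[|M]] // _ /= /dvdnP[k DL].
have <-: 0 |: [set y : L | y ^+ M.+1 == 1] = [set y : L | y ^+ M.+2 == y].
  apply/setP=> y; rewrite !inE; have [->|y0] := eqVneq; first by rewrite !expr0n !eqxx.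
  by rewrite [y ^+ M.+2]exprS -[in RHS]subr_eq0 -[X in _ - X]mulr1 -mulrBr mulf_eq0 (negPf y0) subr_eq0.
by rewrite cardsU1 inE expr0n eq_sym oner_eq0 (@card_nth_roots _ _ k) ?expr1n // mulnC.
Qed.

(** * The norm y^(Q+1) from the field of order Q^2 to that of order Q, inside [L] *)

Section Norm.
Variables (L : finFieldType) (Q : nat).
Hypotheses (Q_gt1 : (1 < Q)%N) (dvdQ : ((Q ^ 2).-1 %| #|L|.-1)%N).
Hypothesis frobD : forall x y : L, (x + y) ^+ Q = x ^+ Q + y ^+ Q.

Let Q2E : (Q ^ 2).-1 = (Q.+1 * Q.-1)%N.
Proof. by case: Q Q_gt1 => // k _ /=; lia. Qed.

Lemma frobN1 : (-1) ^+ Q = -1 :> L.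
Proof.
have := frobD 1 (-1); rewrite subrr expr1n expr0n gtn_eqF ?(ltnW Q_gt1) //= => /esym/eqP.
by rewrite addrC addr_eq0 => /eqP.
Qed.

(** For s nonzero, s^(Q-1) = 1, and (Q+1)(Q-1) divides #|L| - 1, so [card_nth_roots] applies. *)
Lemma card_norm_fiber (s : L) : s ^+ Q = s ->
  #|[set y : L | y ^+ Q.+1 == s]| = if s == 0 then 1%N else Q.+1.
Proof.
move=> Ks; case: eqVneq Ks => [-> _ | s0 Ks].
  have ->: [set y : L | y ^+ Q.+1 == 0] = [set 0]; last by rewrite cards1.
  by apply/setP=> y; rewrite !inE expf_eq0.
have /dvdnP[k DL] := dvdQ.
apply: (@card_nth_roots _ _ (Q.-1 * k)) => //; first by rewrite DL Q2E mulnC mulnA.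
rewrite exprM (_ : s ^+ Q.-1 = 1) ?expr1n //.
by apply: (mulfI s0); rewrite -exprS prednK ?mulr1 // ltnW.
Qed.

Lemma norm_fixed (y : L) : y ^+ (Q ^ 2) = y -> (y ^+ Q.+1) ^+ Q = y ^+ Q.+1.
Proof. by move=> Ky; rewrite -exprM mulSn exprD mulnn Ky exprSr. Qed.

(** Cancelling y^Q in the hypothesis gives the claim; membership in the field of order Q^2 is thus
    automatic once the norm is in the small field. *)
Lemma fixed_of_norm (y : L) : (y ^+ Q.+1) ^+ Q = y ^+ Q.+1 -> y ^+ (Q ^ 2) = y.
Proof.
have [-> _|y0] := eqVneq y 0; first by rewrite expr0n expn_eq0 gtn_eqF ?(ltnW Q_gt1).
rewrite -exprM mulSn exprD mulnn exprSr; apply: mulfI.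
by rewrite expf_neq0.
Qed.

(** The first condition cuts the field of order Q^2 out of the possibly larger [L]. *)
Definition norm_sols1 := [set y : L | (y ^+ (Q ^ 2) == y) && (y ^+ Q.+1 == -1)].

Lemma card_norm_sols1 : #|norm_sols1| = Q.+1.
Proof.
have /card_norm_fiber: (-1) ^+ Q = -1 :> L := frobN1.
rewrite oppr_eq0 oner_eq0 => <-.
apply: eq_card => y; rewrite !inE andbC.
case: eqP => //= yN; apply/eqP/fixed_of_norm.
by rewrite yN frobN1.
Qed.

Definition norm_sols2 := [set yz : (L * L)%type |
  [&& yz.1 ^+ (Q ^ 2) == yz.1, yz.2 ^+ (Q ^ 2) == yz.2 &
      yz.1 ^+ Q.+1 + yz.2 ^+ Q.+1 == -1]].

Lemma card_norm_sols2 : #|norm_sols2| = (Q.+1 * (Q ^ 2 - Q))%N.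
Proof.
pose K := [set s : L | s ^+ Q == s].
have cardK: #|K| = Q.
  rewrite card_fixed_expn //; apply: dvdn_trans dvdQ.
  by rewrite Q2E dvdn_mull.
have K0: (0 : L) \in K by rewrite inE expr0n; case: Q Q_gt1.
have KN1: (-1 : L) \in K by rewrite inE frobN1.
have N1K s : s \in K -> -1 - s \in K.
  by rewrite !inE => /eqP Ks; rewrite -opprD -mulN1r exprMn frobN1 frobD expr1n Ks.
pose N (s : L) := if s == 0 then 1%N else Q.+1.
have NE s : s \in K -> #|[set y : L | y ^+ Q.+1 == s]| = N s.
  by rewrite inE => /eqP; apply: card_norm_fiber.
have ->: #|norm_sols2| = (\sum_(s in K) N s * N (-1 - s)%R)%N.
  rewrite -sum1_card.
  (* Group the solutions by the norm s of the first entry; the second then has norm -1 - s. *)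
  rewrite (partition_big (fun yz : (L * L)%type => yz.1 ^+ Q.+1) (mem K)) /=; last first.
    by move=> yz; rewrite !inE => /and3P[/eqP/norm_fixed/eqP].
  apply: eq_bigr => s Ks; rewrite -NE // -NE ?N1K // -cardsX sum1_card.
  apply: eq_card => -[y z]; rewrite [LHS]unfold_in /= !inE /=.
  have sQ: s ^+ Q = s by move: Ks; rewrite inE => /eqP.
  have sQ': (-1 - s) ^+ Q = -1 - s by move/N1K: Ks; rewrite inE => /eqP.
  apply/andP/andP=> [[/and3P[_ _ /eqP yz] /eqP ys]|[/eqP ys /eqP zs]].
    by rewrite ys -yz ys addrC addKr.
  rewrite ys zs eqxx; split=> //; apply/and3P; split.
  - by apply/eqP/fixed_of_norm; rewrite ys.
  - by apply/eqP/fixed_of_norm; rewrite zs.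
  - by rewrite addrC subrK.
have N10: -1 != 0 :> L by rewrite oppr_eq0 oner_eq0.
(* At s = 0 and s = -1 one of the two norms is 0, giving Q+1 pairs each; the other Q-2 values give
   (Q+1)^2 each. *)
rewrite (bigD1 0) // (bigD1 (-1)) /=; last by rewrite KN1.
rewrite /N eqxx subr0 subrr eqxx (negPf N10).
rewrite (eq_bigr (fun=> (Q.+1 * Q.+1)%N)) => [|s]; last first.
  case/andP=> /andP[_ s0] sN1; rewrite (negPf s0) subr_eq0 eq_sym.
  by rewrite (negPf sN1).
rewrite sum_nat_const.
have ->: #|[pred s | (s \in K) && (s != 0) & s != -1]| = (Q - 2)%N.
  transitivity #|K :\ 0 :\ -1|.
    by apply: eq_card => s; rewrite [LHS]unfold_in /= !inE andbC [X in _ && X]andbC.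
  have KN1': (-1 : L) \in K :\ 0 by rewrite in_setD1 N10.
  have := cardsD1 (0 : L) K; rewrite (cardsD1 (-1 : L) (K :\ 0)) K0 KN1' cardK.
  by move=> ->; rewrite addnA addKn.
by case: Q Q_gt1 => [|[|k]] // _; rewrite subSS subSS subn0; nia.
Qed.

End Norm.
End FiniteFields.

(** * Self-duality of the codes in terms of evaluations at roots of x^n + 1 *)

Section Codes.
Set Implicit Arguments. Unset Strict Implicit. Unset Printing Implicit Defensive.
Import GRing.Theory.
Local Open Scope ring_scope.

(** The identity block gives rank k, half the length, so self-orthogonality already forces equality
    with the dual. *)
Lemma self_dual_systematic (F : fieldType) (k : nat) (M : 'M[F]_k) :
  self_dual (row_mx 1%:M M) = (M *m M^T == - 1%:M).
Proof.
rewrite /self_dual; set G := row_mx _ _.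
have -> : (M *m M^T == - 1%:M) = (G *m G^T == 0).
  by rewrite tr_row_mx mul_row_col trmx1 mulmx1 addrC addr_eq0.
have rG: \rank G = k.
  apply/eqP/row_freeP; exists (col_mx 1%:M 0).
  by rewrite mul_row_col mulmx1 mulmx0 addr0.
apply/idP/eqP => [/andP[/sub_kermxP] // | GG0].
have le: (G <= kermx G^T)%MS by apply/sub_kermxP.
by rewrite -(mxrank_leqif_eq le) mxrank_ker mxrank_tr rG addnK.
Qed.

Section Evaluation.
Variables (F : fieldType) (L : fieldType) (phi : {rmorphism F -> L}) (n : nat).
Implicit Types (a : 'rV[F]_n) (z : L).

Definition ev z a : L := (map_poly phi (rVpoly a)).[z].

Lemma evE z a : ev z a = \sum_(0 <= k < n) phi (coef a k) * z ^+ k.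
Proof.
rewrite /ev (horner_coef_wide z (n := n)); last first.
  by rewrite (leq_trans (size_poly _ _)) // size_poly.
rewrite big_mkord; apply: eq_bigr => k _; rewrite coef_map coef_rVpoly.
by rewrite /coef.
Qed.

Lemma ev_eq0 (rs : seq L) a : uniq rs -> (n <= size rs)%N ->
  {in rs, forall z, ev z a = 0} -> a = 0.
Proof.
move=> Urs Srs a0; apply: (can_inj rVpolyK); rewrite linear0.
apply: (map_poly_inj phi); rewrite rmorph0.
apply: (roots_geq_poly_eq0 (rs := rs)) => //.
  by apply/allP=> z /a0/eqP.
by rewrite size_map_poly (leq_trans (size_poly _ _)).
Qed.

Definition powers z : 'cV[L]_n := \col_i z ^+ i.
Definition has_eigen (M : 'M[F]_n) z (c : L) :=
  map_mx phi M *m powers z = c *: powers z.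

Lemma has_eigenM (M N : 'M_n) z c d :
  has_eigen M z c -> has_eigen N z d -> has_eigen (M *m N) z (c * d).
Proof.
rewrite /has_eigen => Mc Nd.
by rewrite map_mxM -mulmxA Nd -scalemxAr Mc scalerA mulrC.
Qed.

Lemma has_eigenD (M N : 'M_n) z c d :
  has_eigen M z c -> has_eigen N z d -> has_eigen (M + N) z (c + d).
Proof. by rewrite /has_eigen => Mc Nd; rewrite map_mxD mulmxDl Mc Nd scalerDl. Qed.

Lemma has_eigenN (M : 'M_n) z c : has_eigen M z c -> has_eigen (- M) z (- c).
Proof. by rewrite /has_eigen => Mc; rewrite map_mxN mulNmx Mc scaleNr. Qed.

Lemma has_eigen1 z : has_eigen 1%:M z 1.
Proof. by rewrite /has_eigen map_mx1 mul1mx scale1r. Qed.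

Lemma has_eigen_row (M : 'M_n) z c i :
  has_eigen M z c -> ev z (row i M) = c * z ^+ i.
Proof.
move=> /matrixP/(_ i 0); rewrite !mxE => <-; rewrite evE big_mkord.
by apply: eq_bigr => j _; rewrite !mxE /coef valK mxE.
Qed.

(** Each row of M - N, read as a polynomial of degree below n, vanishes at n distinct points. *)
Lemma eigen_inj (rs : seq L) (M N : 'M_n) (c : L -> L) :
    uniq rs -> (n <= size rs)%N ->
    {in rs, forall z, has_eigen M z (c z)} ->
    {in rs, forall z, has_eigen N z (c z)} -> M = N.
Proof.
move=> Urs Srs Mc Nc; apply/eqP; rewrite -subr_eq0; apply/eqP/row_matrixP=> i.
rewrite row0; apply: (ev_eq0 Urs Srs) => z rs_z.
rewrite (has_eigen_row _ (has_eigenD (Mc z rs_z) (has_eigenN (Nc z rs_z)))).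
by rewrite subrr mul0r.
Qed.

Lemma eigen_uniq (M : 'M_n) z c d : (0 < n)%N ->
  has_eigen M z c -> has_eigen M z d -> c = d.
Proof.
move=> n_gt0 Mc Md; pose i := Ordinal n_gt0.
by have := has_eigen_row i Mc; rewrite (has_eigen_row i Md) expr0 !mulr1.
Qed.

Lemma negacirc_row z a (i : 'I_n) : z ^+ n = -1 ->
  \sum_j phi (negacirc a i j) * z ^+ j = z ^+ i * ev z a.
Proof.
move=> zn; have le_in := ltnW (ltn_ord i).
pose f j := if (i <= j)%N then coef a (j - i) else - coef a (n + j - i).
transitivity (\sum_(0 <= j < n) phi (f j) * z ^+ j).
  by rewrite big_mkord; apply: eq_bigr => j _; rewrite mxE.
(* Split at column [i]: the entries to its left have wrapped around, and [z ^+ n = -1] cancels their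
   sign. *)
rewrite evE mulr_sumr (big_cat_nat (leq0n i) le_in) /= [RHS](big_cat_nat (leq0n _) (leq_subr i n)) /=.
rewrite addrC; congr (_ + _).
  rewrite -{1}[val i]add0n big_addn; apply: eq_bigr => k _.
  by rewrite /f leq_addl addnK exprD; ring.
rewrite -{1}[(n - i)%N]add0n big_addn subKn //; apply: eq_big_nat => j /= lt_ji.
rewrite /f leqNgt lt_ji (_ : n + j - i = j + (n - i))%N; last lia.
rewrite rmorphN mulrCA -exprD (_ : i + (j + (n - i)) = j + n)%N; last lia.
by rewrite exprD zn; ring.
Qed.

Lemma negacirc_eigen z a : z ^+ n = -1 -> has_eigen (negacirc a) z (ev z a).
Proof.
move=> zn; apply/matrixP=> i k; rewrite !mxE mulrC -(negacirc_row a i zn).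
by apply: eq_bigr => j _; rewrite !mxE.
Qed.

(* Reversing the order of both rows and columns transposes a negacirculant
   matrix, which reduces this to negacirc_row at 1/z. *)
Lemma negacirc_tr_eigen z a : z ^+ n = -1 ->
  has_eigen (negacirc a)^T z (ev z^-1 a).
Proof.
move=> zn; have zVn: z^-1 ^+ n = -1 by rewrite exprVn zn invrN invr1.
have [n0|n_gt0] := posnP n; first by apply/matrixP=> -[i lt_i]; exfalso; lia.
have z0: z != 0.
  by apply: contra_eq_neq zn => ->; rewrite expr0n gtn_eqF // eq_sym oppr_eq0 oner_eq0.
apply/matrixP=> i k; rewrite !mxE.
(* Reversal replaces z^j by the power n-1-j of 1/z; the factor [z ^+ n.-1] compensates. *)
transitivity (z ^+ n.-1 * (z^-1 ^+ rev_ord i * ev z^-1 a)); last first.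
  rewrite mulrA mulrC exprVn (_ : n.-1 = rev_ord i + i)%N /=; last by have := ltn_ord i; lia.
  by rewrite exprD mulrAC divff ?mul1r // expf_neq0.
rewrite -negacirc_row // mulr_sumr (reindex_inj rev_ord_inj) /=.
apply: eq_bigr => j _; have lt_j := ltn_ord j; have lt_i := ltn_ord i.
rewrite !mxE /= mulrCA; congr (phi _ * _); last first.
  rewrite (_ : n.-1 = (n - j.+1) + j)%N; last lia.
  by rewrite exprD exprVn mulfK // expf_neq0.
rewrite (_ : (n - j.+1 <= i) = (n - i.+1 <= j))%N; last lia.
by case: leqP => ?; [congr coef | congr (- coef _ _)]; lia.
Qed.

Section Roots.
Variable rs : seq L.
Hypotheses (Urs : uniq rs) (Srs : size rs = n) (n_gt0 : (0 < n)%N).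
Hypothesis rsn : {in rs, forall z, z ^+ n = -1}.

Let eigen_eq (M N : 'M[F]_n) (c : L -> L) :
    {in rs, forall z, has_eigen M z (c z)} ->
    {in rs, forall z, has_eigen N z (c z)} -> M = N.
Proof. by apply: eigen_inj; rewrite ?Srs. Qed.

Lemma negacircC a b : negacirc a *m negacirc b = negacirc b *m negacirc a.
Proof.
apply: (@eigen_eq _ _ (fun z => ev z a * ev z b)) => z /rsn zn; last rewrite mulrC;
  by apply: has_eigenM; apply: negacirc_eigen.
Qed.

Lemma negacirc_trC a : (negacirc a)^T *m negacirc a = negacirc a *m (negacirc a)^T.
Proof.
apply: (@eigen_eq _ _ (fun z => ev z a * ev z^-1 a)) => z /rsn zn; first rewrite mulrC;
  by apply: has_eigenM; first [exact: negacirc_eigen | exact: negacirc_tr_eigen].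
Qed.

Lemma eigen_eqN1 (M : 'M[F]_n) (c : L -> L) :
    {in rs, forall z, has_eigen M z (c z)} ->
  (M == - 1%:M) = all (fun z => c z == -1) rs.
Proof.
move=> eigenM.
have eigenN1 z : has_eigen (- 1%:M) z (-1) by apply/has_eigenN/has_eigen1.
apply/eqP/allP => [M1 z rs_z | cN1].
  apply/eqP/(eigen_uniq n_gt0 (eigenM z rs_z)); rewrite M1; exact: eigenN1.
by apply: (@eigen_eq _ _ (fun=> -1)) => z rs_z //; rewrite -(eqP (cN1 z rs_z)); apply: eigenM.
Qed.

Lemma self_dual_dn h :
  self_dual (gen_dn h) = all (fun z => ev z h * ev z^-1 h == -1) rs.
Proof.
rewrite self_dual_systematic; apply: eigen_eqN1 => z /rsn zn.
by apply: has_eigenM; first [exact: negacirc_eigen | exact: negacirc_tr_eigen].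
Qed.

(** In the Gram matrix of the right half, the off-diagonal blocks cancel because A and B commute,
    and both diagonal blocks are A A^t + B B^t because A and B commute with their transposes. *)
Lemma self_dual_fn a b :
  self_dual (gen_fn a b) =
    all (fun z => ev z a * ev z^-1 a + ev z b * ev z^-1 b == -1) rs.
Proof.
set A := negacirc a; set B := negacirc b.
have -> : gen_fn a b = row_mx 1%:M (block_mx A B (- B^T) A^T).
  by rewrite /gen_fn -block_mxEv block_mxEh -!block_mxEv -scalar_mx_block.
have -> : self_dual (row_mx 1%:M (block_mx A B (- B^T) A^T))
        = (A *m A^T + B *m B^T == - 1%:M).
  rewrite self_dual_systematic tr_block_mx mulmx_block linearN /= !trmxK.
  rewrite !mulmxN !mulNmx opprK -!trmx_mul (negacircC b a) !addNr.
  rewrite !negacirc_trC [B *m _ + _]addrC scalar_mx_block opp_block_mx oppr0.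
  by apply/eqP/eqP => [/eq_block_mx[] | ->].
apply: eigen_eqN1 => z /rsn zn; apply: has_eigenD;
  by apply: has_eigenM; first [exact: negacirc_eigen | exact: negacirc_tr_eigen].
Qed.
End Roots.
End Evaluation.
End Codes.

(** * Powers of q modulo p, 4 and 4p *)

Section Orders.
Set Implicit Arguments. Unset Strict Implicit. Unset Printing Implicit Defensive.

Lemma mult_order_dvd m a k j :
  mult_order_is m a k -> a ^ j = 1 %[mod m] -> k %| j.
Proof.
case/and3P=> k_gt0 /eqP ak1 /forallP min_k.
have aM i : a ^ (i * k) = 1 %[mod m] by rewrite mulnC expnM -modnXm ak1 modnXm exp1n.
rewrite {1}(divn_eq j k) expnD -modnMml aM modnMml mul1n => aj1.
have := min_k (Ordinal (ltn_pmod j k_gt0)); rewrite /= aj1 eqxx.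
by rewrite implybF lt0n negbK.
Qed.

Lemma expn_eqmod_cancel m a i j : coprime m a -> i <= j ->
  a ^ i = a ^ j %[mod m] -> a ^ (j - i) = 1 %[mod m].
Proof.
move=> co_ma le_ij /esym/eqP; have [a0|a_gt0] := posnP a.
  by move: co_ma; rewrite a0 /coprime gcdn0 => /eqP->; rewrite !modn1.
rewrite eqn_mod_dvd ?leq_pexp2l // -{1}(subnK le_ij) expnD -[X in _ - X]mul1n -mulnBl.
rewrite Gauss_dvdl ?coprimeXr // -eqn_mod_dvd ?expn_gt0 ?a_gt0 //.
by move/eqP.
Qed.

Section Arithmetic.
Variables p q k : nat.
Hypotheses (p_prime : prime p) (p_mod4 : p %% 4 = 3) (q_mod4 : q %% 4 = 3).
Hypotheses (coprime_pq : coprime p q).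
Hypotheses (ord4p : mult_order_is (4 * p) q (p - 1)).
Hypotheses (ordp : mult_order_is p q k) (k_mod4 : k %% 4 = 2).

Let q_odd : odd q.
Proof. by rewrite -[odd q](@odd_mod _ 4) // q_mod4. Qed.

Let k_even : 2 %| k.
Proof. by rewrite dvdn2 -(@odd_mod k 4) // k_mod4. Qed.

Lemma coprime_4p : coprime (4 * p) q.
Proof. by rewrite coprimeMl coprime_pq andbT (@coprimeXl 2 2) // coprime2n. Qed.

Lemma expq_mod4 j : q ^ j = (if odd j then 3 else 1) %[mod 4].
Proof.
rewrite -[in LHS](odd_double_half j) expnD -mul2n expnM -modnMmr -modnXm -(modnXm 2).
rewrite q_mod4 /= exp1n modnMmr muln1 -modnXm q_mod4.
by case: (odd j).
Qed.

Lemma eqmod_4p m1 m2 : m1 = m2 %[mod 4] -> m1 = m2 %[mod p] -> m1 = m2 %[mod 4 * p].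
Proof.
move=> e4 ep; apply/eqP; rewrite chinese_remainder ?e4 ?ep ?eqxx //.
by rewrite (@coprimeXl 2 2) // coprime2n -(@odd_mod _ 4) // p_mod4.
Qed.

Lemma expq_inj_4p i j : i < p - 1 -> j < p - 1 ->
  q ^ i = q ^ j %[mod 4 * p] -> i = j.
Proof.
wlog le_ij : i j / i <= j => [th | lt_i lt_j] eq_ij.
  by case: (leqP i j) => [|/ltnW] le_ij *; [| symmetry]; apply: th.
have /(mult_order_dvd ord4p) := expn_eqmod_cancel coprime_4p le_ij eq_ij.
have [/eqP|ji_gt0] := posnP (j - i).
  by rewrite subn_eq0 => le_ji _; apply/eqP; rewrite eqn_leq le_ij.
by rewrite gtnNdvd // (leq_ltn_trans (leq_subr _ _)).
Qed.

(** The order k modulo p is even, so i and j have the same parity, which determines the powers of q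
    modulo 4. *)
Lemma expq_eqmod_lift i j : q ^ i = q ^ j %[mod p] -> q ^ i = q ^ j %[mod 4 * p].
Proof.
wlog le_ij : i j / i <= j => [th eq_ij | eq_ij].
  by case: (leqP i j) => [|/ltnW] le_ij; [| symmetry]; apply: th.
have /(mult_order_dvd ordp) k_dvd := expn_eqmod_cancel coprime_pq le_ij eq_ij.
apply: eqmod_4p => //; rewrite !expq_mod4.
have: ~~ odd (j - i) by rewrite -dvdn2 (dvdn_trans k_even).
by rewrite oddB //; case: (odd i); case: (odd j).
Qed.

(** The exponent e = (p-1)/2 is odd, so q^e is -1 modulo 4. Modulo p, q^e is 1 or -1, and 1 would
    make the even order k divide e. *)
Lemma dvd_4p_expq_half : 4 * p %| (q ^ ((p - 1) %/ 2)).+1.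
Proof.
set e := _ %/ 2; have odd_e: odd e by rewrite -(@odd_mod _ 4) /e; lia.
rewrite Gauss_dvd; last first.
  by rewrite (@coprimeXl 2 2) // coprime2n -(@odd_mod _ 4) // p_mod4.
apply/andP; split.
  by rewrite /dvdn -addn1 -modnDml expq_mod4 odd_e.
have /and3P[_ /eqP q1 _] := ord4p.
have: p %| (q ^ e).-1 * (q ^ e).+1.
  have -> : (q ^ e).-1 * (q ^ e).+1 = q ^ (p - 1) - 1.
    have -> : p - 1 = e * 2 by rewrite /e; clear -p_mod4; lia.
    by rewrite expnM -(exp1n 2) subn_sqr subn1 addn1.
  apply: (@dvdn_trans (4 * p)); first exact: dvdn_mull.
  by rewrite -eqn_mod_dvd ?q1 // expn_gt0 odd_gt0.
rewrite Euclid_dvdM // => /orP[p_dvd | //].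
suff /(mult_order_dvd ordp) : q ^ e = 1 %[mod p].
  by move/(dvdn_trans k_even); rewrite dvdn2 odd_e.
by apply/eqP; rewrite eqn_mod_dvd ?subn1 // expn_gt0 odd_gt0.
Qed.

End Arithmetic.
End Orders.

(** Translation by 1 permutes [R], so it leaves the sum of all elements unchanged. *)
Lemma natr_card_eq0 (R : finNzRingType) : (#|R|%:R = 0 :> R)%R.
Proof.
apply: (GRing.addrI (\sum_(x : R) x)%R); rewrite GRing.addr0 -GRing.sumr_const.
by rewrite -big_split /= [RHS](reindex_inj (GRing.addIr 1%R)).
Qed.

(** * Frobenius powers over [F] acting on evaluations *)

Section Frobenius.
Set Implicit Arguments. Unset Strict Implicit. Unset Printing Implicit Defensive.
Import GRing.Theory.
Local Open Scope ring_scope.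
Variables (F L : finFieldType) (phi : {rmorphism F -> L}).

Lemma frob_add j (x y : L) :
  (x + y) ^+ (#|F| ^ j) = x ^+ (#|F| ^ j) + y ^+ (#|F| ^ j).
Proof.
have [p p_prime pcharF] := finPcharP F; apply: exprDn_pchar.
rewrite (card_pprimeChar pcharF : #|F| = _) -expnM pnatX pnatE //.
by rewrite (fmorph_pchar phi) pcharF.
Qed.

Lemma frob_phi j (c : F) : phi c ^+ (#|F| ^ j) = phi c.
Proof.
rewrite -rmorphXn; congr (phi _).
by elim: j => [|j IHj]; rewrite ?expr1 // expnS exprM expf_card.
Qed.

Lemma ev_frob n (a : 'rV[F]_n) j (z : L) :
  ev phi z a ^+ (#|F| ^ j) = ev phi (z ^+ (#|F| ^ j)) a.
Proof.
have F0 : (0 < #|F| ^ j)%N by rewrite expn_gt0 (ltnW (card_finNzRing_gt1 F)).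
rewrite !evE !big_mkord.
rewrite (big_morph _ (frob_add j) (_ : 0 ^+ _ = 0)); last by rewrite expr0n gtn_eqF.
by apply: eq_bigr => i _; rewrite exprMn frob_phi exprAC.
Qed.

Lemma evB n (a b : 'rV[F]_n) (z : L) :
  ev phi z (a - b) = ev phi z a - ev phi z b.
Proof. by rewrite /ev linearB rmorphB hornerD hornerN. Qed.

End Frobenius.

(** * Evaluation at conjugacy representatives and the two counts *)

Section Counting.
Set Implicit Arguments. Unset Strict Implicit. Unset Printing Implicit Defensive.
Import GRing.Theory.
Local Open Scope ring_scope.

Lemma card_preimset_inj (T U : finType) (f : T -> U) (D : {set U}) :
  injective f -> D \subset [set f x | x : T] -> #|f @^-1: D| = #|D|.
Proof.
move=> inj_f /subsetP sDf; rewrite -(card_imset _ inj_f); apply: eq_card => y.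
apply/imsetP/idP => [[x] | Dy]; first by rewrite inE => Dfx ->.
by have /imsetP[x _ Dx] := sDf y Dy; exists x; rewrite // inE -Dx.
Qed.

Variables (F L : finFieldType) (phi : {rmorphism F -> L}) (p k : nat) (z : L).
Let q := #|F|.
Let n := (2 * p)%N.
Let r := (q ^ ((p - 1) %/ 2))%N.
Hypotheses (p_prime : prime p) (p_mod4 : (p %% 4 = 3)%N) (q_mod4 : (q %% 4 = 3)%N).
Hypotheses (coprime_pq : coprime p q).
Hypotheses (ord4p : mult_order_is (4 * p) q (p - 1)).
Hypotheses (ordp : mult_order_is p q k) (k_mod4 : (k %% 4 = 2)%N).
Hypothesis prim_z : (4 * p)%N.-primitive_root z.
Hypothesis r2_dvd : ((r ^ 2).-1 %| #|L|.-1)%N.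

Let p_gt0 : (0 < p)%N. Proof. exact: prime_gt0. Qed.
Let odd_p : odd p. Proof. by rewrite -(@odd_mod p 4) // p_mod4. Qed.
Let odd_q : odd q. Proof. by rewrite -(@odd_mod q 4) // q_mod4. Qed.
Let n_gt0 : (0 < n)%N. Proof. by rewrite muln_gt0. Qed.
Let q_gt1 : (1 < q)%N. Proof. exact: card_finNzRing_gt1. Qed.
Let r_gt1 : (1 < r)%N.
Proof. by rewrite -(expn0 q) ltn_exp2l // divn_gt0 //; clear -p_mod4 p_gt0; lia. Qed.
Let r2E : (r ^ 2 = q ^ (p - 1))%N.
Proof. by rewrite -expnM; congr (_ ^ _)%N; clear -p_mod4; lia. Qed.
Let q2_dvd : ((q ^ 2).-1 %| #|L|.-1)%N.
Proof.
apply: dvdn_trans r2_dvd; rewrite r2E.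
have -> : (p - 1 = 2 * ((p - 1) %/ 2))%N by clear -p_mod4; lia.
by rewrite expnM [X in (_ %| X)%N]predn_exp dvdn_mulr.
Qed.

Lemma z_expn : z ^+ n = -1.
Proof.
have: (z ^+ n) ^+ 2 == 1 by rewrite -exprM -(prim_order_dvd prim_z) /n mulnAC.
rewrite sqrf_eq1 => /orP[|/eqP //]; rewrite -(prim_order_dvd prim_z) /n.
by rewrite dvdn_pmul2r.
Qed.

Let oppz : - z = z ^+ n.+1. Proof. by rewrite exprSr z_expn mulN1r. Qed.

(* One root of each of the irreducible factors x^2+1, g_1 and g_2. *)
Definition reps := [:: z ^+ p; z; - z].

(** Exponents of [z] along the Frobenius orbits of z^p, z and -z = z^(n+1), of lengths 2, p-1 and
    p-1. *)
Definition orbit_exps := [seq (p * q ^ j)%N | j <- iota 0 2]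
  ++ [seq (q ^ j)%N | j <- iota 0 (p - 1)]
  ++ [seq (n.+1 * q ^ j)%N | j <- iota 0 (p - 1)].

Definition conj_roots := [seq z ^+ e | e <- orbit_exps].

Lemma size_conj_roots : size conj_roots = n.
Proof. by rewrite size_map !size_cat !size_map !size_iota /n; clear -p_gt0; lia. Qed.

Lemma conj_rootsP x : x \in conj_roots -> exists2 y, y \in reps & exists j, x = y ^+ (q ^ j).
Proof.
case/mapP=> e + ->; rewrite !mem_cat => /or3P[] /mapP[j _ ->].
- by exists (z ^+ p); rewrite ?inE ?eqxx //; exists j; rewrite exprM.
- by exists z; rewrite ?inE ?eqxx ?orbT //; exists j.
- by exists (- z); rewrite ?inE ?eqxx ?orbT //; exists j; rewrite exprM -oppz.
Qed.

Lemma reps_conj y : y \in reps -> y \in conj_roots.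
Proof.
have p1_gt0: (0 < p - 1)%N by clear -p_mod4; lia.
have conj_exp e : e \in orbit_exps -> z ^+ e \in conj_roots by exact: map_f.
rewrite !inE => /or3P[] /eqP->.
- apply: conj_exp; rewrite !mem_cat; apply/or3P/Or31/mapP.
  by exists 0%N; rewrite ?mem_iota ?muln1.
- have := conj_exp 1%N; rewrite expr1; apply; rewrite !mem_cat; apply/or3P/Or32/mapP.
  by exists 0%N; rewrite ?mem_iota.
- rewrite oppz; apply: conj_exp; rewrite !mem_cat; apply/or3P/Or33/mapP.
  by exists 0%N; rewrite ?mem_iota ?muln1.
Qed.

Lemma conj_rootsn : {in conj_roots, forall x, x ^+ n = -1}.
Proof.
move=> _ /mapP[e e_in ->]; rewrite exprAC z_expn -signr_odd.
suff -> : odd e by [].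
by move: e_in; rewrite !mem_cat => /or3P[] /mapP[j _ ->];
  rewrite ?oddM ?oddX ?odd_p ?odd_q ?orbT //= /n oddM.
Qed.

(** Exponents are compared modulo 4p. Within an orbit the orders of q modulo 4 and 4p separate them;
    the orbit of z^p is the one whose exponents p divides. *)
Lemma uniq_conj_roots : uniq conj_roots.
Proof.
have eqP4p i j : (z ^+ i == z ^+ j) = (i == j %[mod 4 * p]) := eq_prim_root_expr prim_z i j.
have modp i j : i = j %[mod 4 * p] -> i = j %[mod p].
  by move=> eq_ij; rewrite -(modn_dvdm i (dvdn_mull 4 (dvdnn p))) eq_ij modn_dvdm // dvdn_mull.
have pqF j : (q ^ j %% p != 0)%N.
  rewrite -/(dvdn _ _); apply: contraL coprime_pq => p_dvd.
  by rewrite prime_coprime // negbK; move: p_dvd; rewrite Euclid_dvdX // => /andP[].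
have n1p j : (n.+1 * q ^ j = q ^ j %[mod p])%N.
  by rewrite mulSn addnC /n mulnAC modnMDl.
have inj_pow c : (forall j, c * q ^ j = q ^ j %[mod p])%N ->
    uniq [seq z ^+ (c * q ^ j) | j <- iota 0 (p - 1)].
  move=> cp; rewrite map_inj_in_uniq ?iota_uniq // => i j.
  rewrite !mem_iota !add0n /= => lt_i lt_j /eqP; rewrite eqP4p => /eqP/modp.
  rewrite !cp => /(expq_eqmod_lift p_mod4 q_mod4 coprime_pq ordp k_mod4).
  exact: (expq_inj_4p q_mod4 coprime_pq ord4p).
rewrite /conj_roots !map_cat -!map_comp !cat_uniq; apply/and5P; split.
- rewrite map_inj_in_uniq ?iota_uniq // => i j.
  rewrite !mem_iota !add0n /= => lt_i lt_j /eqP; rewrite eqP4p [(4 * p)%N]mulnC -!muln_modr.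
  rewrite eqn_pmul2l // !(expq_mod4 q_mod4).
  by case: i lt_i => [|[|]] //; case: j lt_j => [|[|]].
- apply/hasPn=> x; rewrite mem_cat => /orP[] /mapP[j _ ->];
  by apply/mapP=> -[i _ /eqP]; rewrite /= eqP4p => /eqP/modp/esym/eqP; rewrite ?n1p modnMr eq_sym (negPf (pqF _)).
- rewrite (_ : map _ _ = [seq z ^+ (1 * q ^ j) | j <- iota 0 (p - 1)]).
    by apply: inj_pow => j; rewrite mul1n.
  by apply: eq_map => j; rewrite /= mul1n.
(* The orbits of z and -z agree modulo p, so a coincidence lifts to q^j = q^i modulo 4p; modulo 4
   this contradicts n + 1 = 3. *)
- apply/hasPn=> x /mapP[j _ ->]; apply/mapP=> -[i _ /eqP]; rewrite /= eqP4p => /eqP eq_ij.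
  have := modp _ _ eq_ij; rewrite n1p => /(expq_eqmod_lift p_mod4 q_mod4 coprime_pq ordp k_mod4) eq_ij'.
  have: (n.+1 * q ^ j = q ^ j %[mod 4])%N.
    by rewrite -(modn_dvdm _ (dvdn_mulr p (dvdnn 4))) eq_ij -eq_ij' modn_dvdm // dvdn_mulr.
  rewrite -modnMml -modnMmr -[RHS]modn_mod !expq_mod4 // (_ : n.+1 = 3 %[mod 4]); last by clear -p_mod4; rewrite /n; lia.
  by case: odd.
- exact: inj_pow.
Qed.

(** The value -1 is fixed by the odd power q^j, so the condition is constant along Frobenius
    orbits. *)
Lemma all_conj_roots (N : L -> L) :
    (forall x j, N (x ^+ (q ^ j)) = N x ^+ (q ^ j)) ->
  all (fun x => N x == -1) conj_roots = all (fun x => N x == -1) reps.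
Proof.
move=> Nfrob; apply/allP/allP => [N1 y /reps_conj /N1 // | N1 x].
case/conj_rootsP=> y /N1/eqP Ny [j ->].
by rewrite Nfrob Ny -signr_odd oddX odd_q orbT.
Qed.

Section Conjugation.
Variables (j : nat) (x : L).
Hypothesis xQ : x ^+ (q ^ j).+1 = 1.

Let xQV : x ^+ (q ^ j) = x^-1.
Proof.
have x0 : x != 0 by apply: contra_eq_neq xQ => ->; rewrite expr0n eq_sym oner_eq0.
by apply: (mulfI x0); rewrite -exprS xQ divff.
Qed.

Lemma ev_conj (a : 'rV[F]_n) : ev phi x^-1 a = ev phi x a ^+ (q ^ j).
Proof. by rewrite (ev_frob phi) xQV. Qed.

Lemma ev_norm (a : 'rV[F]_n) : ev phi x a * ev phi x^-1 a = ev phi x a ^+ (q ^ j).+1.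
Proof. by rewrite ev_conj exprS. Qed.

Lemma ev_fixed (a : 'rV[F]_n) : ev phi x a ^+ ((q ^ j) ^ 2) = ev phi x a.
Proof. by rewrite -mulnn exprM -ev_conj (ev_frob phi) exprVn xQV invrK. Qed.

End Conjugation.

Lemma zp_norm : (z ^+ p) ^+ (q ^ 1).+1 = 1.
Proof.
apply/eqP; rewrite -exprM -(prim_order_dvd prim_z) mulnC dvdn_pmul2l // expn1.
by clear -q_mod4; rewrite /dvdn; lia.
Qed.

Lemma z_norm : z ^+ r.+1 = 1.
Proof.
apply/eqP; rewrite -(prim_order_dvd prim_z).
exact: dvd_4p_expq_half ord4p ordp k_mod4.
Qed.

Lemma Nz_norm : (- z) ^+ r.+1 = 1.
Proof. by rewrite exprNn z_norm mulr1 -signr_odd /= oddX odd_q orbT. Qed.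

Definition crt (a : 'rV[F]_n) : (L * (L * L))%type :=
  (ev phi (z ^+ p) a, (ev phi z a, ev phi (- z) a)).

Definition crt2 (ab : 'rV[F]_n * 'rV[F]_n) : ((L * L) * ((L * L) * (L * L)))%type :=
  ((ev phi (z ^+ p) ab.1, ev phi (z ^+ p) ab.2),
   ((ev phi z ab.1, ev phi z ab.2), (ev phi (- z) ab.1, ev phi (- z) ab.2))).

(** The difference vanishes at the three representatives, hence by Frobenius at all n conjugates. *)
Lemma crt_inj : injective crt.
Proof.
move=> a b [e1 e2 e3]; apply/eqP; rewrite -subr_eq0; apply/eqP.
apply: (@ev_eq0 _ _ phi _ conj_roots); rewrite ?uniq_conj_roots ?size_conj_roots //.
move=> x /conj_rootsP[y rep_y [j ->]].
rewrite -(ev_frob phi) evB.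
have -> : ev phi y a = ev phi y b by move: rep_y; rewrite !inE => /or3P[] /eqP->.
by rewrite subrr expr0n gtn_eqF // expn_gt0 ltnW.
Qed.

Definition fixed_pow (Q : nat) := [set y : L | y ^+ (Q ^ 2) == y].

(** Inclusion holds since Frobenius squared fixes the values; equality follows by size, as q^2
    q^(p-1) q^(p-1) = q^n. *)
Lemma crt_image :
  [set crt a | a : 'rV[F]_n] = setX (fixed_pow q) (setX (fixed_pow r) (fixed_pow r)).
Proof.
apply/eqP; rewrite eqEcard; apply/andP; split.
  apply/subsetP=> _ /imsetP[a _ ->]; rewrite !inE /=.
  by rewrite -{1}[q]expn1 (ev_fixed zp_norm) (ev_fixed z_norm) (ev_fixed Nz_norm) !eqxx.
rewrite card_imset; last exact: crt_inj.
have sq_gt1 Q : (1 < Q -> 1 < Q ^ 2)%N by rewrite -{2}(exp1n 2) ltn_exp2r.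
rewrite !cardsX !card_fixed_expn ?sq_gt1 //.
rewrite card_mx r2E -!expnD mul1n leq_pexp2l ?(ltnW q_gt1) //.
by rewrite /n; clear -p_gt0; lia.
Qed.

Lemma crt2_inj : injective crt2.
Proof.
move=> [a b] [a' b'] [e1 e2 e3 e4 e5 e6].
by congr (_, _); apply: crt_inj; congr (_, (_, _)).
Qed.

Lemma count_dn : #|[set h : 'rV[F]_n | self_dual (gen_dn h)]| = (q.+1 * r.+1 ^ 2)%N.
Proof.
have <- : #|setX (norm_sols1 L q) (setX (norm_sols1 L r) (norm_sols1 L r))| = (q.+1 * r.+1 ^ 2)%N.
  by rewrite !cardsX !card_norm_sols1 ?mulnn // => x y; rewrite -1?[q]expn1 (frob_add phi).
rewrite -(card_preimset_inj crt_inj); last first.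
  rewrite crt_image; apply/subsetP=> -[x [y w]]; rewrite !inE /=.
  by case/and3P=> /andP[-> _] /andP[-> _] /andP[-> _].
apply: eq_card => h; rewrite !inE /= (self_dual_dn phi uniq_conj_roots size_conj_roots n_gt0 conj_rootsn).
rewrite all_conj_roots /= ?andbT; last first.
  by move=> x j; rewrite -exprVn -!(ev_frob phi) exprMn.
rewrite (ev_norm zp_norm) (ev_norm z_norm) (ev_norm Nz_norm) -{2}[q]expn1.
by rewrite (ev_fixed zp_norm) (ev_fixed z_norm) (ev_fixed Nz_norm) !eqxx expn1.
Qed.

Lemma count_fn :
  #|[set ab : 'rV[F]_n * 'rV[F]_n | self_dual (gen_fn ab.1 ab.2)]|
    = (q.+1 * (q ^ 2 - q) * (r.+1 * (r ^ 2 - r)) ^ 2)%N.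
Proof.
set D := setX (norm_sols2 L q) (setX (norm_sols2 L r) (norm_sols2 L r)).
have <- : #|D| = (q.+1 * (q ^ 2 - q) * (r.+1 * (r ^ 2 - r)) ^ 2)%N.
  by rewrite !cardsX !card_norm_sols2 ?mulnn // => x y; rewrite -1?[q]expn1 (frob_add phi).
rewrite -(card_preimset_inj crt2_inj); last first.
  apply/subsetP=> -[[x1 y1] [[x2 y2] [x3 y3]]]; rewrite !inE /=.
  case/and3P=> /and3P[x1K y1K _] /and3P[x2K y2K _] /and3P[x3K y3K _].
  (* [crt2] is [crt] on each component, regrouped by evaluation point, so a and b are recovered
     separately. *)
  have /imsetP[a _ [-> -> ->]] : (x1, (x2, x3)) \in [set crt a | a : 'rV[F]_n].
    by rewrite crt_image !inE x1K x2K x3K.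
  have /imsetP[b _ [-> -> ->]] : (y1, (y2, y3)) \in [set crt a | a : 'rV[F]_n].
    by rewrite crt_image !inE y1K y2K y3K.
  by apply/imsetP; exists (a, b).
apply: eq_card => -[a b]; rewrite !inE /= (self_dual_fn phi uniq_conj_roots size_conj_roots n_gt0 conj_rootsn).
rewrite all_conj_roots /= ?andbT; last first.
  by move=> x j; rewrite -exprVn -!(ev_frob phi) -!exprMn -(frob_add phi).
rewrite !(ev_norm zp_norm) !(ev_norm z_norm) !(ev_norm Nz_norm) -{3 4}[q]expn1.
by rewrite !(ev_fixed zp_norm) !(ev_fixed z_norm) !(ev_fixed Nz_norm) !eqxx expn1.
Qed.

End Counting.

Theorem theorem4p3 (F : finFieldType) (p q n : nat)
  (hp : prime p) (hp4 : p %% 4 = 3)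
  (hq : #|F| = q) (hq4 : q %% 4 = 3) (hpq : coprime p q)
  (hn : n = 2 * p)
  (hord4p : mult_order_is (4 * p) q (p - 1))
  (hordp : exists2 k, mult_order_is p q k & k %% 4 = 2) :
  #|[set h : 'rV[F]_n | self_dual (gen_dn h)]|
    = (q + 1) * (q ^ ((p - 1) %/ 2) + 1) ^ 2
  /\
  #|[set ab : 'rV[F]_n * 'rV[F]_n | self_dual (gen_fn ab.1 ab.2)]|
    = (q + 1) * (q ^ 2 - q) * (q ^ ((p - 1) %/ 2) + 1) ^ 2
        * (q ^ (p - 1) - q ^ ((p - 1) %/ 2)) ^ 2.
Proof.
case: hordp => k ordp k_mod4; rewrite hn.
set r := q ^ _.
have r2E : r ^ 2 = q ^ (p - 1) by rewrite -expnM; congr (_ ^ _); clear -hp4; lia.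
have q_gt1 : 1 < q by rewrite -hq card_finNzRing_gt1.
(* In [F] the number r^2, a positive power of #|F|, is 0, so r^2 - 1 becomes -1. *)
have N0 : ((r ^ 2).-1%:R != 0 :> F)%R.
  rewrite -subn1 GRing.natrB ?expn_gt0 ?(ltnW q_gt1) // r2E GRing.natrX -hq natr_card_eq0.
  by rewrite GRing.expr0n gtn_eqF ?GRing.sub0r ?GRing.oppr_eq0 ?GRing.oner_eq0 // subn_gt0 prime_gt1.
(* Order r^2 - 1 rather than 4p makes [L] contain the full field of order r^2; a power of [w] then
   serves as the primitive 4p-th root. *)
have [L [phi [w prim_w]]] := prim_root_extension N0.
have r2_dvd := prim_root_dvd_card prim_w.
have p4_dvd : 4 * p %| (r ^ 2).-1.
  have /dvdn_trans := dvd_4p_expq_half hp hp4 hq4 hpq hord4p ordp k_mod4.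
  by apply; rewrite -/r -subn1 -(exp1n 2) subn_sqr addn1 dvdn_mull.
have prim_z := dvdn_prim_root prim_w p4_dvd.
subst q.
rewrite -r2E (count_dn phi hp hp4 hq4 hpq hord4p ordp k_mod4 prim_z r2_dvd).
rewrite (count_fn phi hp hp4 hq4 hpq hord4p ordp k_mod4 prim_z r2_dvd).
by rewrite !addn1 expnMn mulnA.
Qed.
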